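(* Let $P$ be a barotropic equation of state satisfying the assumptions given in the context. Then the set of physically admissible primitive states $G_p$ and the set of conservative vectors $$G_c=\left\{\boldsymbol U=(\mathcal T^{00},\mathcal T^{01})^\top\in\mathbb R^2:\ \boldsymbol U\cdot\boldsymbol n>0\ \text{ for both } \boldsymbol n=(1,1)^\top \text{ and } \boldsymbol n=(1,-1)^\top\right\}$$ (equivalently, $\mathcal T^{00}>|\mathcal T^{01}|$) are equivalent descriptions of the admissible states: a vector $\boldsymbol U\in\mathbb R^2$ belongs to $G_c$ if and only if it is the conservative vector $\boldsymbol U(\boldsymbol V)$ of a primitive state $\boldsymbol V=(\rho,p,v)^\top\in G_p$ with $p=P(\rho)$. Furthermore, the set $G_c$ is convex.
   Context: Equation of state: $p=P(\rho)$, where $P$ is a differentiable function on $[0,\infty)$ with $P(0)=0$, $0<P'(\rho)<1$, and $P(\rho)<\sqrt{P'(\rho)}\,\rho$ for $\rho>0$. (The speed of light is $1$.) Primitive variables: $\boldsymbol V=(\rho,p,v)^\top$ (energy density, pressure, velocity). Admissible set in primitive variables: $G_p=\{(\rho,p,v)^\top:\ \rho>0,\ p>0,\ |v|<1\}$. Conservative variables: with Lorentz factor $W=1/\sqrt{1-v^2}$, $\boldsymbol U(\boldsymbol V)=(\mathcal T^{00},\mathcal T^{01})^\top$, where $\mathcal T^{00}=(\rho+p)W^2-p$ and $\mathcal T^{01}=(\rho+p)W^2v$. *)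

(* Defs.v *)
From mathcomp Require Import all_boot all_order all_algebra.
From mathcomp Require Import all_classical all_reals all_analysis.
Import Order.TTheory GRing.Theory Num.Theory.
Import numFieldNormedType.Exports.

Set Implicit Arguments.
Unset Strict Implicit.
Unset Printing Implicit Defensive.

Local Open Scope classical_set_scope.
Local Open Scope ring_scope.

(* P is a total function R -> R, but only its values on [0, +oo[ matter:
   differentiability at the endpoint 0 is one-sided. *)
Definition differentiable_0y (R : realType) (P : R -> R) : Prop :=
  (forall x : R, 0 < x -> derivable P x 1) /\
  cvg (h^-1 * (P h - P 0) @[h --> (0 : R)^'+]).

Definition barotropic_eos (R : realType) (P : R -> R) : Prop :=
  [/\ differentiable_0y P,
      P 0 = 0,
      forall rho : R, 0 < rho -> 0 < derive1 P rho < 1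
    & forall rho : R, 0 < rho -> P rho < Num.sqrt (derive1 P rho) * rho].

Record primitive_state (R : realType) := PrimitiveState {
  density : R;  (* the energy density rho *)
  pressure : R;
  velocity : R  (* in units where the speed of light is 1 *)
}.

Definition Gp (R : realType) : set (primitive_state R) :=
  [set V | [/\ 0 < density V, 0 < pressure V & `|velocity V| < 1]].

Definition lorentz (R : realType) (v : R) : R := (Num.sqrt (1 - v ^+ 2))^-1.

Definition T00 (R : realType) (V : primitive_state R) : R :=
  (density V + pressure V) * lorentz (velocity V) ^+ 2 - pressure V.

Definition T01 (R : realType) (V : primitive_state R) : R :=
  (density V + pressure V) * lorentz (velocity V) ^+ 2 * velocity V.

Definition vec2 (R : realType) (a b : R) : 'cV[R]_2 :=
  \col_(i < 2) (if i == 0 then a else b).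

Definition conservative (R : realType) (V : primitive_state R) : 'cV[R]_2 :=
  vec2 (T00 V) (T01 V).

Definition dot (R : realType) (U n : 'cV[R]_2) : R :=
  \sum_(i < 2) U i 0 * n i 0.

Definition Gc (R : realType) : set 'cV[R]_2 :=
  [set U | 0 < dot U (vec2 1 1) /\ 0 < dot U (vec2 1 (-1))].

(* Main.v *)
Require Import Defs.
From mathcomp Require Import all_boot all_order all_algebra.
From mathcomp Require Import all_classical all_reals all_analysis.
From mathcomp Require Import ring lra.
Import Order.TTheory GRing.Theory Num.Theory.
Import numFieldNormedType.Exports.

(** Write [E] for the first component of [U], [m] for the second, and [p] for
    [P rho].

    The conservative vector of a primitive state lies in the cone [|m| < E]
    because [T00 + T01] and [T00 - T01] factor as
    [(1 + v) * (rho + p * v) / (1 - v ^+ 2)] and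
    [(1 - v) * (rho - p * v) / (1 - v ^+ 2)], and every factor is positive
    once [p < rho].  The bound [p < rho] is what the hypothesis
    [P rho < sqrt (P' rho) * rho] gives, as the sound speed [sqrt (P' rho)] is
    less than 1 ([conservative_Gc], [eos_lt_density]).

    Conversely, in [U = conservative V] one has [E + p = (rho + p) * W ^+ 2],
    so that [v = m / (E + p)]; eliminating [v] leaves the single scalar
    equation [(E - rho) * (E + p) = m ^+ 2] for the density.  Its left-hand
    side is continuous in [rho] on [[0, E]] and falls from [E ^+ 2 > m ^+ 2]
    at [0] to [0 <= m ^+ 2] at [E], so the intermediate value theorem yields a
    positive root ([density_root]).  The pressure at the root is positive,
    since [P] increases from [P 0 = 0] ([eos_gt0]), and the resulting velocity
    is below 1 because [|m| < E < E + p] ([conservative_recovery]).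

    The cone is an intersection of two open half-planes, hence convex. *)

Local Open Scope classical_set_scope.
Local Open Scope ring_scope.

Lemma dot_vec2 {R : realType} (U : 'cV[R]_2) (a b : R) :
  dot U (vec2 a b) = U 0 0 * a + U 1 0 * b.
Proof.
rewrite /dot big_ord_recl big_ord1 !mxE /=.
by have -> : lift ord0 ord0 = 1 :> 'I_2 by exact/val_inj.
Qed.

Lemma Gc_norm_lt {R : realType} (U : 'cV[R]_2) : Gc U <-> `|U 1 0| < U 0 0.
Proof.
rewrite /Gc /= !dot_vec2 ltr_norml; split=> [[Up Um]|/andP[Ul Ur]].
  by apply/andP; split; lra.
by split; lra.
Qed.

Lemma convex_Gc (R : realType) : convex_set (@Gc R).
Proof.
apply/convex_setW => x y /[!inE] -[xp xm] [yp ym] l l0 l1.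
have l'0 : 0 < 1 - l%:num by rewrite subr_gt0.
move: xp xm yp ym; rewrite !dot_vec2 => xp xm yp ym.
have E i : (conv l x y : 'cV[R]_2) i 0 = l%:num * x i 0 + (1 - l%:num) * y i 0.
  by rewrite !mxE.
rewrite inE; split; rewrite dot_vec2 !E.
- have := addr_gt0 (mulr_gt0 l0 xp) (mulr_gt0 l'0 yp); lra.
- have := addr_gt0 (mulr_gt0 l0 xm) (mulr_gt0 l'0 ym); lra.
Qed.

(** The increment is the step times the difference quotient, and the latter
    has a finite limit. *)
Lemma cvg_right_slope_continuous {R : realType} {f : R -> R} :
  cvg (h^-1 * (f h - f 0) @[h --> (0 : R)^'+]) ->
  f h @[h --> (0 : R)^'+] --> f 0.
Proof.
move=> slope.
have hid : (fun h : R => h) @ 0^'+ --> (0 : R).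
  by apply: (@cvg_at_right_filter _ _ idfun); exact: cvg_id.
have incr0 : h * (h^-1 * (f h - f 0)) @[h --> (0 : R)^'+] -->
    0 * lim (h^-1 * (f h - f 0) @[h --> (0 : R)^'+]).
  by apply: cvgM; [exact: hid|exact: slope].
have : h * (h^-1 * (f h - f 0)) + f 0 @[h --> (0 : R)^'+] --> f 0.
  rewrite -[X in _ --> X]add0r; rewrite mul0r in incr0.
  by apply: cvgD; [exact: incr0|exact: cvg_cst].
apply: cvg_trans; apply: near_eq_cvg; near=> h.
have h0 : h != 0 by rewrite gt_eqF.
by rewrite mulVKf // subrK.
Unshelve. all: by end_near. Qed.

Lemma differentiable_0y_continuous {R : realType} {f : R -> R} (b : R) :
  differentiable_0y f -> 0 < b -> {within `[0, b], continuous f}.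
Proof.
move=> [df slope] b0.
have cf x : 0 < x -> {for x, continuous f}.
  by move=> x0; apply/differentiable_continuous/derivable1_diffP/df.
apply/continuous_within_itvP => //; split.
- by move=> x /[!in_itv]/= /andP[x0 _]; exact: cf.
- exact: cvg_right_slope_continuous.
- by apply: cvg_at_left_filter; exact: cf.
Qed.

Lemma eos_gt0 {R : realType} {P : R -> R} {rho : R} :
  barotropic_eos P -> 0 < rho -> 0 < P rho.
Proof.
move=> [dP P0 P' _] rho0.
have itvP' x : x \in `]0, rho[%R -> 0 < x by rewrite in_itv => /andP[].
rewrite -[X in X < _]P0.
apply: (@gtr0_derive1_lt_cc _ P 0 rho) => //.
- by move=> x /itvP'; exact: dP.1.
- by move=> x /itvP' x0; case/andP: (P' x x0).
- exact: differentiable_0y_continuous.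
- by rewrite in_itv /= lexx ltW.
- by rewrite in_itv /= lexx ltW.
Qed.

(** The sound speed [sqrt (P' rho)] is less than 1. *)
Lemma eos_lt_density {R : realType} {P : R -> R} {rho : R} :
  barotropic_eos P -> 0 < rho -> P rho < rho.
Proof.
move=> [_ _ P' Plt] rho0.
case/andP: (P' rho rho0) => P'0 P'1.
apply: (lt_le_trans (Plt rho rho0)).
by rewrite ger_pMl // -[leRHS]sqrtr1 ler_sqrt // ltW.
Qed.

(** Existence of a density for a given conservative vector [(E, m)], by the
    intermediate value theorem on [[0, E]]; the left-hand side is [E ^+ 2] at
    [rho = 0] and [0] at [rho = E]. *)
Lemma density_root {R : realType} {P : R -> R} {E m : R} :
  {within `[0, E], continuous P} -> P 0 = 0 -> `|m| < E ->
  exists2 rho, 0 < rho & (E - rho) * (E + P rho) = m ^+ 2.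
Proof.
move=> cP P0 mE; have E0 : 0 < E by exact: le_lt_trans mE.
have m2E2 : m ^+ 2 < E ^+ 2.
  by rewrite -real_normK ?num_real// ltr_pXn2r ?nnegrE ?normr_ge0 ?ltW.
pose F rho := (E - rho) * (E + P rho).
have F0 : F 0 = E ^+ 2 by rewrite /F P0 subr0 addr0 expr2.
have FE : F E = 0 by rewrite /F subrr mul0r.
have cF : {within `[0, E], continuous F}.
  move=> x; apply: cvgM; last by apply: cvgD; [exact: cvg_cst|exact: cP].
  apply: cvgB; first exact: cvg_cst.
  by move: x; apply: continuous_subspaceT => x; exact: cvg_id.
have [|rho] := @IVT _ F 0 E (m ^+ 2) (ltW E0) cF.
  by rewrite F0 FE ge_min le_max sqr_ge0 (ltW m2E2) /= orbT.
rewrite in_itv /= => /andP[rho0 _] Frho; exists rho => //.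
(* The root is not 0, where the value [E ^+ 2] exceeds [m ^+ 2]. *)
rewrite lt_neqAle rho0 andbT; apply: contraTneq m2E2 => rhoE.
by rewrite -Frho -rhoE F0 ltxx.
Qed.

Lemma sqr_lorentz {R : realType} (v : R) : `|v| < 1 ->
  lorentz v ^+ 2 = (1 - v ^+ 2)^-1.
Proof.
move=> v1; rewrite /lorentz exprVn sqr_sqrtr // subr_ge0.
by rewrite -real_normK ?num_real// exprn_ile1 // ltW.
Qed.

(** Positivity of [T00 + T01] and [T00 - T01] is read off their factorizations.
    Both signs of [v] occur, whence the bound on [`|p * v|]. *)
Lemma conservative_Gc {R : realType} (V : primitive_state R) :
  Gp V -> pressure V < density V -> Gc (conservative V).
Proof.
case: V => rho p v [/= rho0 p0 v1] prho.
apply/Gc_norm_lt; rewrite !mxE /= /T00 /T01 /= sqr_lorentz //.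
move: (v1); rewrite ltr_norml => /andP[vl vr].
have w0 : 0 < 1 - v ^+ 2 by nra.
have pv : p * `|v| < rho by apply: lt_trans prho; rewrite gtr_pMr.
have [pvl pvr] : p * v < rho /\ - rho < p * v.
  have := pv; rewrite -[X in X * `|v|](gtr0_norm p0) -normrM ltr_norml.
  by case/andP.
have w'0 : 0 < (1 - v ^+ 2)^-1 by rewrite invr_gt0.
have wN : 1 - v ^+ 2 != 0 by rewrite gt_eqF.
rewrite ltr_norml; apply/andP; split; rewrite -subr_gt0.
- have -> : (rho + p) / (1 - v ^+ 2) * v - - ((rho + p) / (1 - v ^+ 2) - p)
     = (1 + v) * (rho + p * v) / (1 - v ^+ 2) by field.
  by rewrite !mulr_gt0 //; lra.
- have -> : (rho + p) / (1 - v ^+ 2) - p - (rho + p) / (1 - v ^+ 2) * v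
     = (1 - v) * (rho - p * v) / (1 - v ^+ 2) by field.
  by rewrite !mulr_gt0 //; lra.
Qed.

(** The scalar equation is equivalent to
    [1 - v ^+ 2 = (rho + p) / (E + p)] for [v = m / (E + p)], that is,
    to [(rho + p) * W ^+ 2 = E + p]; the formulas for [T00] and [T01] then
    give back [E] and [m]. *)
Lemma conservative_recovery {R : realType} {E m rho p : R} :
  `|m| < E -> 0 < rho -> 0 < p -> (E - rho) * (E + p) = m ^+ 2 ->
  let V := PrimitiveState rho p (m / (E + p)) in
  [/\ Gp V, T00 V = E & T01 V = m].
Proof.
move=> mE rho0 p0 root V; have E0 : 0 < E by exact: le_lt_trans mE.
have Ep0 : 0 < E + p by exact: addr_gt0.
have EpN : E + p != 0 by rewrite gt_eqF.
have v1 : `|m / (E + p)| < 1.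
  rewrite normrM normfV (gtr0_norm Ep0) ltr_pdivrMr // mul1r.
  by apply: (lt_trans mE); rewrite ltrDl.
have rhopN : rho + p != 0 by rewrite gt_eqF ?addr_gt0.
have enthalpy : (rho + p) * lorentz (m / (E + p)) ^+ 2 = E + p.
  rewrite sqr_lorentz //.
  have -> : 1 - (m / (E + p)) ^+ 2 = (rho + p) / (E + p).
    by rewrite expr_div_n -root; field.
  by rewrite invf_div mulrCA divff // mulr1.
split; first by split.
- by rewrite /T00 /= enthalpy addrK.
- by rewrite /T01 /= enthalpy mulrCA divff // mulr1.
Qed.

Theorem theorem2p4 (R : realType) (P : R -> R) (hP : barotropic_eos P) :
  [/\ forall U : 'cV[R]_2, Gc U <-> `|U 1 0| < U 0 0,
      forall U : 'cV[R]_2,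
        Gc U <->
        exists V : primitive_state R,
          [/\ Gp V, pressure V = P (density V) & U = conservative V]
    & convex_set (@Gc R)].
Proof.
split; [exact: Gc_norm_lt| |exact: convex_Gc].
move=> U; split=> [/Gc_norm_lt mE|[V [GpV pV ->]]]; last first.
  apply: conservative_Gc => //; rewrite pV.
  by case: GpV => rho0 _ _; exact: eos_lt_density.
have E0 : 0 < U 0 0 by exact: le_lt_trans mE.
case: (hP) => dP P0 _ _.
have [rho rho0 root] :=
  density_root (differentiable_0y_continuous _ dP E0) P0 mE.
have [GpV T00V T01V] :=
  conservative_recovery mE rho0 (eos_gt0 hP rho0) root.
exists (PrimitiveState rho (P rho) (U 1 0 / (U 0 0 + P rho))); split=> //.
apply/matrixP => i j; rewrite (ord1 j) !mxE T00V T01V.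
case: (i =P 0) => [->//|/eqP i0]; congr (U _ 0); apply/val_inj.
by case: i i0 => -[|[|i]].
Qed.
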